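(* For every $n\ge2$: no $\omega\in\widetilde{S}_n$ avoids $123$; exactly one $\omega\in\widetilde{S}_n$ (the identity) avoids $132$, and exactly one (the identity) avoids $213$; and the number of $\omega\in\widetilde{S}_n$ avoiding $231$ equals the number avoiding $312$, both being $\binom{2n-1}{n}$. Equivalently, with $f^p(t)=\sum_{n\ge2}\#\{\omega\in\widetilde{S}_n:\omega\text{ avoids }p\}\,t^n$, we have $f^{123}(t)=0$, $f^{132}(t)=f^{213}(t)=\sum_{n\ge2}t^n$, and $f^{231}(t)=f^{312}(t)=\sum_{n\ge2}\binom{2n-1}{n}t^n$.
   Context: For $n\ge 2$, the affine symmetric group $\widetilde{S}_n$ is the set of bijections $\omega:\mathbb{Z}\to\mathbb{Z}$ such that $\omega(i+n)=\omega(i)+n$ for all $i\in\mathbb{Z}$ and $\sum_{i=1}^n\omega(i)=\binom{n+1}{2}$; write $\omega_i=\omega(i)$. For $p\in S_k$, $\omega$ contains $p$ if there exist integers $i_1<\cdots<i_k$ such that $\omega_{i_1}\cdots\omega_{i_k}$ has the same relative order as $p_1\cdots p_k$; otherwise $\omega$ avoids $p$. *)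

(* Defs.v *)
From HB Require Import structures.
From mathcomp Require Import all_boot all_order all_algebra.
Set Implicit Arguments. Unset Strict Implicit. Unset Printing Implicit Defensive.
Import Order.TTheory GRing.Theory Num.Theory.
Local Open Scope ring_scope.

Definition affine_perm (n : nat) (w : int -> int) : Prop :=
  bijective w /\
  (forall i : int, w (i + n%:Z) = w i + n%:Z) /\
  (\sum_(1 <= i < n.+1) w i%:Z = ('C(n.+1, 2))%:Z).

(* A pattern p in S_k is given as its one-line notation p_1 ... p_k (a seq nat). *)
Definition contains (w : int -> int) (p : seq nat) : Prop :=
  exists idx : seq int,
    size idx = size p /\ sorted (fun a b : int => a < b) idx /\
    (forall a b : nat, (a < size p)%N -> (b < size p)%N ->
       (w (nth 0 idx a) < w (nth 0 idx b)) = (nth 0%N p a < nth 0%N p b)%N).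

Definition avoids (w : int -> int) (p : seq nat) : Prop := ~ contains w p.

(* The window [omega_1, ..., omega_n]; it determines omega in ~S_n. *)
Definition window (n : nat) (w : int -> int) : seq int :=
  [seq w i%:Z | i <- iota 1 n].

(* #{omega in ~S_n : omega avoids p} = k, counted via the (injective) window map. *)
Definition num_avoiders (n : nat) (p : seq nat) (k : nat) : Prop :=
  exists s : seq (seq int),
    uniq s /\ size s = k /\
    (forall v : seq int,
       v \in s <-> exists w, affine_perm n w /\ avoids w p /\ v = window n w).

(* Main.v *)
(* A pattern 132 arises from any descent by appending a far translate to its left, so 132-avoiders are increasing, hence the identity; reverse-complement exchanges 132 with 213 and 231 with 312.
   A 231-avoider [w] is determined by its suffix minima [m i = min_(j >= i) w j], as in stack sorting: [w i - m i] is the number of inversions [(i, j)], these [j] form an interval directly to the right of [i], and the intervals are laminar (as soon as [m j <= w i] for some [j > i], also [w j < w i]). Conversely each monotone [m] with [m (i + n) = m i + n] comes from a 231-avoider, with [w i - m i] the least [k] such that [m (i + k + 1) > m i + k]. Up to translation, fixed by the sum condition, such an [m] is a weakly increasing sequence of [n - 1] numbers in [0, ..., n], so there are ['C(2n - 1, n - 1)] of them. *)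
Require Import Defs.
From HB Require Import structures.
From mathcomp Require Import all_boot all_order all_algebra.
From mathcomp Require Import zify ring.
Set Implicit Arguments. Unset Strict Implicit. Unset Printing Implicit Defensive.
Import Order.TTheory GRing.Theory Num.Theory.
Local Open Scope ring_scope.

(** * Shift-equivariant functions, residues and the sum condition *)

Definition shift_equivariant (n : nat) (f : int -> int) : Prop :=
  forall i : int, f (i + n%:Z) = f i + n%:Z.

Lemma shift_equivariantM n f : shift_equivariant n f ->
  forall i q : int, f (i + q * n%:Z) = f i + q * n%:Z.
Proof.
move=> fP i q; case: q => q.
  elim: q => [|q IH]; first by rewrite !mul0r !addr0.
  by rewrite intS mulrDl mul1r addrCA addrC fP IH; ring.
elim: q => [|q IH].
  by have := fP (i - n%:Z); rewrite subrK NegzE mulN1r => ->; ring.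
have := fP (i + Negz q.+1 * n%:Z).
rewrite (_ : i + _ + n%:Z = i + Negz q * n%:Z) ?IH; last by rewrite !NegzE !intS; ring.
by move=> fE; apply: (addIr n%:Z); rewrite -fE !NegzE !intS; ring.
Qed.

Lemma eq_shift_equivariant n f g : (0 < n)%N ->
  shift_equivariant n f -> shift_equivariant n g ->
  (forall i : nat, (i < n)%N -> f i%:Z = g i%:Z) -> f =1 g.
Proof.
move=> n_gt0 fP gP fg i.
have n0 : n%:Z != 0 by lia.
have := ltz_pmod i (_ : 0 < n%:Z); have := modz_ge0 i n0.
rewrite [in f i](divz_eq i n%:Z) [in g i](divz_eq i n%:Z).
case: (modz _ _) => // r _ rn; rewrite addrC !shift_equivariantM // fg //.
by apply: rn; lia.
Qed.

(** If [f i] and [f j] agree modulo [n], equivariance makes [f i] the value of [f] at a translate of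
    [j] by a multiple of [n]. Injectivity then forces [i] and [j] to be congruent. *)
Lemma shift_equivariant_residue n f : (0 < n)%N ->
  shift_equivariant n f -> injective f ->
  exists2 r : 'I_n -> 'I_n, injective r &
    forall i : 'I_n, f i%:Z = (f i%:Z %/ n%:Z)%Z * n%:Z + (r i)%:Z.
Proof.
move=> n_gt0 fP fI; have n0 : n%:Z != 0 by lia.
have rP i : (absz (f i %% n%:Z)%Z < n)%N.
  by have := ltz_pmod (f i) (_ : 0 < n%:Z); have := modz_ge0 (f i) n0; lia.
have fE (i : 'I_n) :
    f i%:Z = (f i%:Z %/ n%:Z)%Z * n%:Z + (absz (f i%:Z %% n%:Z)%Z)%:Z.
  by have := divz_eq (f i%:Z) n%:Z; have := modz_ge0 (f i%:Z) n0; lia.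
exists (fun i : 'I_n => Ordinal (rP i%:Z)) => // i j [eq_r].
have := fE i; rewrite eq_r; have := fE j.
move: (absz _) (divz _ _) (divz _ _) => c a b fi fj.
have/fI ij : f i%:Z = f (j%:Z + (a - b) * n%:Z).
  by rewrite shift_equivariantM // {}fi {}fj; ring.
apply: val_inj; have := ltn_ord i; have := ltn_ord j.
rewrite /=; move: (nat_of_ord i) (nat_of_ord j) ij => {fE fi fj eq_r}i {}j; move: (a - b) => d.
case: d => [[|d]|d]; nia.
Qed.

Lemma shift_equivariant_bij n f : (0 < n)%N ->
  shift_equivariant n f -> injective f -> bijective f.
Proof.
move=> n_gt0 fP fI; have n0 : n%:Z != 0 by lia.
have [r rI rE] := shift_equivariant_residue n_gt0 fP fI.
have [r' _ r'K] := injF_bij rI.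
have surj v : exists i, f i == v.
  have vP : (absz (v %% n%:Z)%Z < n)%N.
    by have := ltz_pmod v (_ : 0 < n%:Z); have := modz_ge0 v n0; lia.
  pose i := r' (Ordinal vP); have := rE i; rewrite r'K /=.
  move: (divz _ _) => a fi.
  exists (i%:Z + ((v %/ n%:Z)%Z - a) * n%:Z).
  rewrite shift_equivariantM // fi gez0_abs ?modz_ge0 //.
  by rewrite {3}(divz_eq v n%:Z); apply/eqP; ring.
exists (fun v => xchoose (surj v)) => v; last exact/eqP/(xchooseP (surj v)).
exact/fI/eqP/(xchooseP (surj (f v))).
Qed.

(** Since [f n = f 0 + n], the window [1..n] can be traded for [0..n-1], so that sums range over
    ordinals. *)
Lemma sum_window n f : shift_equivariant n f ->
  \sum_(1 <= i < n.+1) f i%:Z = \sum_(i < n) f i%:Z + n%:Z.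
Proof.
move=> fP; have := fP 0; rewrite add0r => fn.
have := big_nat_recr n 0 (fun i : nat => f i%:Z) (leq0n n) (op := +%R) (idx := 0).
by rewrite big_ltn //= fn big_mkord addrA [_ + f 0]addrC -addrA => /addrI ->.
Qed.

Lemma bin2_window n : 'C(n.+1, 2)%:Z = \sum_(i < n) i%:Z + n%:Z.
Proof.
rewrite -bin2_sum big_nat_recr //= PoszD; congr (_ + _).
by rewrite big_mkord (big_morph _ PoszD (erefl _)).
Qed.

Lemma affine_permE n f : shift_equivariant n f -> bijective f ->
  affine_perm n f <-> \sum_(i < n) f i%:Z = \sum_(i < n) i%:Z.
Proof.
move=> fP fB; rewrite /affine_perm sum_window // bin2_window.
by split=> [[_ [_ /addIr]]|->].
Qed.

(** The residues of [f] permute [0..n-1], so its sum over [0..n-1] is off by [n] times the sum of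
    the quotients. Adding a constant [s] changes that sum by [n * s], which dictates this value. *)
Definition centering (n : nat) (f : int -> int) : int :=
  - \sum_(i < n) (f i%:Z %/ n%:Z)%Z.

Lemma affine_perm_centering n f : (0 < n)%N ->
  shift_equivariant n f -> injective f ->
  affine_perm n (fun i => f i + centering n f).
Proof.
move=> n_gt0 fP fI.
have [r rI rE] := shift_equivariant_residue n_gt0 fP fI.
have gP s : shift_equivariant n (fun i => f i + s).
  by move=> i; rewrite fP addrAC.
apply/(affine_permE (gP _)).
  by apply: (shift_equivariant_bij n_gt0 (gP _)) => i j /addIr/fI.
rewrite big_split /= sumr_const card_ord /centering.
rewrite (eq_bigr _ (fun i _ => rE i)) big_split /= -mulr_suml.
rewrite -(reindex_inj rI (P := xpredT) (F := fun i : 'I_n => i%:Z)) /=.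
by rewrite -mulr_natr natz; ring.
Qed.

(** * From a monotone equivariant function to a laminar permutation *)

Section StackWord.

Variables (n : nat) (m : int -> int).
Hypotheses (n_gt0 : (0 < n)%N) (mP : shift_equivariant n m).
Hypothesis m_homo : {homo m : i j / i <= j}.

(** The offset [n.-1] always satisfies the test, because [m (i + n) = m i + n]. Searching below [n]
    therefore finds the least such offset among all naturals. *)
Definition arc (i : int) : nat :=
  find (fun k : nat => m i + k%:Z < m (i + k.+1%:Z)) (iota 0 n).

Definition stack_word (i : int) : int := m i + (arc i)%:Z.

Lemma has_arc i : has (fun k : nat => m i + k%:Z < m (i + k.+1%:Z)) (iota 0 n).
Proof.
apply/hasP; exists n.-1; first by rewrite mem_iota; lia.
by rewrite prednK // mP; lia.
Qed.

Lemma arc_lt i : (arc i < n)%N.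
Proof. by have := has_arc i; rewrite has_find size_iota. Qed.

Lemma arcP i : stack_word i < m (i + (arc i).+1%:Z).
Proof. by have := nth_find 0%N (has_arc i); rewrite nth_iota ?arc_lt. Qed.

Lemma arc_min i (k : nat) : (k < arc i)%N -> m (i + k.+1%:Z) <= m i + k%:Z.
Proof.
move=> k_arc; have := before_find 0%N k_arc.
by rewrite nth_iota ?(ltn_trans k_arc (arc_lt i)) // add0n => /negbT; rewrite -leNgt.
Qed.

Lemma stack_word_ge i : m i <= stack_word i.
Proof. by rewrite lerDl. Qed.

Lemma stack_word_shift : shift_equivariant n stack_word.
Proof.
move=> i; rewrite /stack_word mP.
suff -> : arc (i + n%:Z) = arc i by lia.
by apply: eq_find => k; rewrite mP [i + _ + _]addrAC mP [m i + _ + _]addrAC ltrD2r.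
Qed.

(** The position [j] lies within the arc of [i], so minimality of that arc gives
    [m j <= m i + (j - i) - 1]. Counting up from [m j] at [j] thus passes the end of the arc of [i],
    where [m] exceeds [stack_word i], before reaching the value [stack_word i]. The arc of [j] must
    stop earlier. *)
Lemma stack_word_laminar (i j : int) :
  i < j -> m j <= stack_word i -> stack_word j < stack_word i.
Proof.
move=> ij mj_le; have arci := arcP i.
have j_le : j <= i + (arc i)%:Z.
  by rewrite leNgt; apply/negP => j_gt; have := m_homo (_ : i + (arc i).+1%:Z <= j); lia.
have mj : m j <= m i + (j - i) - 1.
  have := @arc_min i (absz (j - i - 1)%R).
  by rewrite (_ : i + _ = j); lia.
rewrite ltNge; apply/negP => wij.
have := @arc_min j (absz (stack_word i - m j)%R).
have := m_homo (_ : i + (arc i).+1%:Z <= j + (absz (stack_word i - m j)%R).+1%:Z).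
rewrite /stack_word in arci mj_le wij *.
(* A longer arc at [j] is impossible, since the offset [stack_word i - m j] already passes the test.
   This leaves equal values, excluded by the offset one smaller, which still lands at or beyond
   [i + (arc i).+1]. *)
case: (ltnP (absz (m i + Posz (arc i) - m j)%R) (arc j)) => [lt|ge]; first lia.
have -> : (m i + (arc i)%:Z - m j) = (arc j)%:Z by lia.
have := @arc_min j (arc j).-1.
have := m_homo (_ : i + (arc i).+1%:Z <= j + (arc j).-1.+1%:Z).
lia.
Qed.

Lemma stack_word_inj : injective stack_word.
Proof.
move=> i j wij; case: (ltrgtP i j) => // ij.
  by have := stack_word_laminar ij; have := stack_word_ge j; lia.
by have := stack_word_laminar ij; have := stack_word_ge i; lia.
Qed.

End StackWord.

(** * Suffix minima *)

Definition suffix_min (w m : int -> int) : Prop :=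
  (forall i j : int, i <= j -> m i <= w j) /\
  (forall i : int, exists2 j, i <= j & w j = m i).

Section SuffixMin.

Variables (w m : int -> int).
Hypothesis wm : suffix_min w m.

Lemma suffix_min_homo : {homo m : i j / i <= j}.
Proof.
move=> i j ij; have [k jk <-] := wm.2 j.
exact: wm.1 (le_trans ij jk).
Qed.

Lemma suffix_min_unique w' m' : w =1 w' -> suffix_min w' m' -> m =1 m'.
Proof.
move=> ww' wm' i; apply/eqP; rewrite eq_le.
have [k ik wk] := wm.2 i; have [k' ik' wk'] := wm'.2 i.
by rewrite -{1}wk' -ww' (wm.1 _ _ ik') -wk ww' (wm'.1 _ _ ik).
Qed.

Lemma suffix_min_add s : suffix_min (fun i => w i + s) (fun i => m i + s).
Proof.
split=> [i j ij|i]; first by rewrite lerD2r wm.1.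
by have [j ij wj] := wm.2 i; exists j => //; rewrite wj.
Qed.

Lemma suffix_min_shift n : shift_equivariant n w -> shift_equivariant n m.
Proof.
move=> wP i; have [k ik wk] := wm.2 i; have [l il wl] := wm.2 (i + n%:Z).
have := wm.1 (i + n%:Z) (k + n%:Z); rewrite wP.
have := wm.1 i (l - n%:Z); have := wP (l - n%:Z); rewrite subrK.
lia.
Qed.

End SuffixMin.

(** The minimum over [i, ..., i + n - 1] suffices: every later position is one of these plus a
    nonnegative multiple of [n], and its value is at least as large. *)
Lemma suffix_min_ex n w : (0 < n)%N -> shift_equivariant n w ->
  exists m, suffix_min w m.
Proof.
move=> n_gt0 wP; pose k0 : 'I_n := Ordinal n_gt0.
pose a i := [arg min_(k < k0) w (i + (nat_of_ord k)%:Z)]%O.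
exists (fun i => w (i + (nat_of_ord (a i))%:Z)); split=> [i j ij|i]; last first.
  by exists (i + (nat_of_ord (a i))%:Z) => //; lia.
rewrite /a; case: arg_minP => //= k _ k_min.
have n0 : n%:Z != 0 by lia.
have := ltz_pmod (j - i) (_ : 0 < n%:Z); have := modz_ge0 (j - i) n0.
have := divz_eq (j - i) n%:Z; move: (modz _ _) (divz _ _) => [r|//] q jE _ rn.
have {}rn : (r < n)%N by lia.
rewrite (_ : j = (i + r%:Z) + q * n%:Z); last by lia.
have q_ge0 : 0 <= q by case: q jE => // q; rewrite NegzE; nia.
rewrite shift_equivariantM //; apply: le_trans (k_min (Ordinal rn) isT) _.
by rewrite lerDl mulr_ge0.
Qed.

Lemma stack_word_suffix_min n m : (0 < n)%N -> shift_equivariant n m ->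
  {homo m : i j / i <= j} -> suffix_min (stack_word n m) m.
Proof.
move=> n_gt0 mP m_homo; split=> [i j ij|i].
  exact: le_trans (m_homo _ _ ij) (stack_word_ge _ _ _).
(* The minimum is attained at the end [i + k] of the plateau of [m] through [i], where the arc has
   length zero. *)
have [|k /[dup] kP] := @ex_minnP (fun k : nat => m i < m (i + k.+1%:Z)).
  exists n.-1; rewrite prednK // mP; lia.
move=> ik k_min; exists (i + k%:Z); first lia.
have mk : m (i + k%:Z) = m i.
  apply/eqP; rewrite eq_le; apply/andP; split; last by apply: m_homo; lia.
  rewrite leNgt; apply/negP; case: k kP ik k_min => [|k] kP ik k_min.
    by rewrite addr0 ltxx.
  by move/k_min; rewrite ltnn.
suff: arc n m (i + k%:Z) = 0%N by rewrite /stack_word mk => ->; rewrite addr0.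
rewrite /arc; case: n n_gt0 {mP} => //= n _.
by rewrite mk addr0 -addrA -PoszD addn1 ik.
Qed.

(** * A laminar bijection is determined by its lower bound [m] *)

Definition laminar (m w : int -> int) : Prop :=
  forall i j : int, i < j -> m j <= w i -> w j < w i.

Lemma laminar_eq (m w w' : int -> int) : {homo m : i j / i <= j} ->
    (forall i, m i <= w i) -> (forall i, m i <= w' i) ->
    bijective w -> bijective w' -> laminar m w -> laminar m w' ->
  w =1 w'.
Proof.
move=> m_homo mw mw' wB wB' lam lam'.
(* The induction on the height [k] above [m] is symmetric in [w] and [w'], because treating one
   function uses smaller heights of both. *)
suff main (k : nat) i : (w i = m i + k%:Z -> w' i = w i) /\
                        (w' i = m i + k%:Z -> w i = w' i).
  by move=> i; apply/esym/(main (absz (w i - m i)%R) i).1; have := mw i; lia.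
(* Compare [i] with the position [p] of the value [u i] in [u']: if [p <> i], laminarity yields a smaller instance. *)
elim/ltn_ind: k i => k IH i.
have step u u' : (forall j, m j <= u j) -> (forall j, m j <= u' j) ->
    bijective u' -> laminar m u -> laminar m u' ->
    (forall j, u j < m j + k%:Z -> u' j = u j) ->
    (forall j, u' j < m j + k%:Z -> u j = u' j) ->
    u i = m i + k%:Z -> u' i = u i.
  move=> mu mu' [v vK v'K] lamu lamu' IHu IHu' ui.
  have := v'K (u i); set p := v (u i) => u'p.
  case: (ltrgtP p i) => [pi|ip|pi]; last by rewrite -{1}pi.
    have u'i : u' i < u' p by apply: lamu' => //; rewrite u'p; apply: mu.
    by have := IHu' i; lia.
  have up : u p < u i by apply: lamu => //; rewrite -u'p; apply: mu'.
  by have := IHu p; have := m_homo _ _ (ltW ip); lia.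
split; [apply: (step w w') | apply: (step w' w)] => // j lt_k.
- by apply: (IH (absz (w j - m j)%R) _ j).1; have := mw j; lia.
- by apply: (IH (absz (w' j - m j)%R) _ j).2; have := mw' j; lia.
- by apply: (IH (absz (w' j - m j)%R) _ j).2; have := mw' j; lia.
by apply: (IH (absz (w j - m j)%R) _ j).1; have := mw j; lia.
Qed.

(** * Windows and occurrences of patterns of length three *)

Lemma eq_from_window n f g : (0 < n)%N ->
  shift_equivariant n f -> shift_equivariant n g ->
  window n f = window n g -> f =1 g.
Proof.
move=> n_gt0 fP gP /eq_in_map fg; apply: (eq_shift_equivariant n_gt0) => // i i_lt.
case: i i_lt => [|i] i_lt; last by apply: fg; rewrite mem_iota; lia.
(* The window starts at [1], so the value at [0] is recovered from the one at [n]. *)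
have := fg n; rewrite mem_iota => /(_ ltac:(lia)).
have := fP 0; have := gP 0; rewrite !add0r => -> -> /addIr; exact.
Qed.

Lemma contains3P w (a b c : nat) :
  contains w [:: a; b; c] <->
  exists i j k : int, [/\ i < j, j < k,
    [/\ (w i < w i) = (a < a)%N, (w i < w j) = (a < b)%N & (w i < w k) = (a < c)%N],
    [/\ (w j < w i) = (b < a)%N, (w j < w j) = (b < b)%N & (w j < w k) = (b < c)%N] &
    [/\ (w k < w i) = (c < a)%N, (w k < w j) = (c < b)%N & (w k < w k) = (c < c)%N]].
Proof.
split=> [[s [s_size []]]|].
  case: s s_size => [|i [|j [|k []]]] //= _ /andP[ij /andP[jk _]] H.
  exists i, j, k; split=> //; split.
  - exact: (H 0%N 0%N isT isT). - exact: (H 0%N 1%N isT isT). - exact: (H 0%N 2%N isT isT).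
  - exact: (H 1%N 0%N isT isT). - exact: (H 1%N 1%N isT isT). - exact: (H 1%N 2%N isT isT).
  - exact: (H 2%N 0%N isT isT). - exact: (H 2%N 1%N isT isT). - exact: (H 2%N 2%N isT isT).
move=> [i [j [k [ij jk [? ? ?] [? ? ?] [? ? ?]]]]].
exists [:: i; j; k]; split=> //; split; first by rewrite /= ij jk.
by move=> [|[|[|//]]] [|[|[|//]]].
Qed.

Lemma contains231P w : contains w [:: 2; 3; 1]%N <->
  exists i j k : int, [/\ i < j, j < k, w k < w i & w i < w j].
Proof.
split=> [/contains3P[i [j [k [ij jk [_ wij _] _ [wki _ _]]]]]|].
  by exists i, j, k; rewrite wij wki.
move=> [i [j [k [ij jk wki wij]]]]; apply/contains3P; exists i, j, k.
by split=> //; split=> /=; lia.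
Qed.

Lemma contains132P w : contains w [:: 1; 3; 2]%N <->
  exists i j k : int, [/\ i < j, j < k, w i < w k & w k < w j].
Proof.
split=> [/contains3P[i [j [k [ij jk [_ _ wik] _ [_ wkj _]]]]]|].
  by exists i, j, k; rewrite wik wkj.
move=> [i [j [k [ij jk wik wkj]]]]; apply/contains3P; exists i, j, k.
by split=> //; split=> /=; lia.
Qed.

Lemma contains123P w : contains w [:: 1; 2; 3]%N <->
  exists i j k : int, [/\ i < j, j < k, w i < w j & w j < w k].
Proof.
split=> [/contains3P[i [j [k [ij jk [_ wij _] [_ _ wjk] _]]]]|].
  by exists i, j, k; rewrite wij wjk.
move=> [i [j [k [ij jk wij wjk]]]]; apply/contains3P; exists i, j, k.
by split=> //; split=> /=; lia.
Qed.

(** * Reverse-complement symmetry *)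

(** This is the half-turn of the graph about the point with both coordinates [(n + 1) / 2], a centre
    for which the index set [1..n] is preserved. *)
Definition rev_compl (n : nat) (w : int -> int) (i : int) : int :=
  n.+1%:Z - w (n.+1%:Z - i).

Lemma rev_complK n w : rev_compl n (rev_compl n w) =1 w.
Proof. by move=> i; rewrite /rev_compl !subKr. Qed.

Lemma eq_contains w w' p : w =1 w' -> contains w p -> contains w' p.
Proof.
by move=> ww' [s [sz [ss H]]]; exists s; do 2!split=> //; move=> *; rewrite -!ww' H.
Qed.

(** The six equations say that [a' b' c'] is ordered like the reverse-complement of [a b c]. In this
    form they hold by computation for concrete patterns. *)
Lemma contains_rev_compl n w (a b c a' b' c' : nat) :
    (a' < b')%N = (b < c)%N -> (b' < a')%N = (c < b)%N ->
    (b' < c')%N = (a < b)%N -> (c' < b')%N = (b < a)%N ->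
    (a' < c')%N = (a < c)%N -> (c' < a')%N = (c < a)%N ->
  contains w [:: a; b; c] -> contains (rev_compl n w) [:: a'; b'; c'].
Proof.
move=> e1 e2 e3 e4 e5 e6 /contains3P[i [j [k [ij jk [? ? ?] [? ? ?] [? ? ?]]]]].
apply/contains3P; exists (n.+1%:Z - k), (n.+1%:Z - j), (n.+1%:Z - i).
rewrite /rev_compl !subKr !ltrD2l !ltrN2.
by split=> //; split; rewrite ?e1 ?e2 ?e3 ?e4 ?e5 ?e6 ?ltnn ?ltxx.
Qed.

Lemma affine_perm_rev_compl n w : (0 < n)%N ->
  affine_perm n w -> affine_perm n (rev_compl n w).
Proof.
move=> n_gt0 [[w' wK w'K] [wP w_sum]]; split; [|split].
- exists (rev_compl n w') => i; rewrite /rev_compl.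
    by rewrite !subKr wK subKr.
  by rewrite !subKr w'K subKr.
- move=> i; rewrite /rev_compl; have := wP (n.+1%:Z - (i + n%:Z)).
  rewrite (_ : _ - _ + _ = n.+1%:Z - i); [lia | ring].
rewrite big_nat_rev /= sumrB sumr_const_nat subn1 /= -mulr_natr natz.
rewrite (eq_big_nat _ _ (F2 := fun i : nat => w i%:Z)) ?w_sum; last first.
  by move=> i i_n; congr (w _); lia.
(* The sum became [n (n + 1)] minus ['C(n.+1, 2)], and [n (n + 1)] is twice that binomial. *)
by have := mul_bin_diag n.+1 1; rewrite /= bin1; lia.
Qed.

Lemma num_avoiders_rev_compl n (a b c a' b' c' k : nat) : (0 < n)%N ->
    (a' < b')%N = (b < c)%N -> (b' < a')%N = (c < b)%N ->
    (b' < c')%N = (a < b)%N -> (c' < b')%N = (b < a)%N ->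
    (a' < c')%N = (a < c)%N -> (c' < a')%N = (c < a)%N ->
  num_avoiders n [:: a; b; c] k -> num_avoiders n [:: a'; b'; c'] k.
Proof.
move=> n_gt0 h1 h2 h3 h4 h5 h6 [s [s_uniq [s_size sP]]].
(* The action of [rev_compl] on windows; being injective, it carries one enumeration to the
   other. *)
pose f (v : seq int) := [seq n.+1%:Z - x | x <- rev v].
have fw w : f (window n w) = window n (rev_compl n w).
  rewrite /f /window -map_rev -map_comp.
  apply: (@eq_from_nth _ 0); rewrite !size_map size_rev // size_iota => i i_lt.
  rewrite !(nth_map 0%N) ?size_rev ?size_iota // nth_rev ?size_iota //=.
  by rewrite !nth_iota /rev_compl; [congr (_ - w _)|..]; lia.
have fI : injective f by move=> u v /inj_map/= H; apply/(can_inj revK)/H => x y; lia.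
have rc w : contains w [:: a'; b'; c'] -> contains (rev_compl n w) [:: a; b; c].
  exact: contains_rev_compl.
have rc' w : contains (rev_compl n w) [:: a'; b'; c'] -> contains w [:: a; b; c].
  by move/rc; apply: eq_contains; apply: rev_complK.
exists (map f s); rewrite map_inj_uniq // size_map; do 2!split=> //.
move=> v; split=> [/mapP[u /sP[w [wA [w_av ->]]] ->]|[w [wA [w_av ->]]]].
  exists (rev_compl n w); split; first exact: affine_perm_rev_compl.
  by split=> // /rc'.
have -> : window n w = f (window n (rev_compl n w)).
  by rewrite fw; apply: eq_map => i; rewrite rev_complK.
apply: map_f; apply/sP; exists (rev_compl n w).
split; first exact: affine_perm_rev_compl.
split=> // rcw; apply: w_av; apply: (eq_contains (@rev_complK n w)).
exact: contains_rev_compl rcw.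
Qed.

(** * The patterns 132 and 123 *)

Lemma affine_perm_id n : affine_perm n id.
Proof. by apply/affine_permE => //; exists id. Qed.

(** Each of [n] consecutive increments is at least [1] and they add up to [n], so all equal [1].
    Thus [w] is a translation, and the sum condition makes it trivial. *)
Lemma affine_perm_increasing n w : (0 < n)%N -> affine_perm n w ->
  (forall i : int, w i < w (i + 1)) -> w =1 id.
Proof.
move=> n_gt0 wA w_incr; have [wB [wP _]] := wA.
have grow (i : int) (j : nat) : w i + j%:Z <= w (i + j%:Z).
  elim: j => [|j IH]; first by rewrite !addr0.
  have := w_incr (i + j%:Z); rewrite (_ : i + j%:Z + 1 = i + j.+1%:Z); lia.
have wS (i : int) : w (i + 1) = w i + 1.
  have := grow (i + 1) n.-1; rewrite (_ : i + 1 + n.-1%:Z = i + n%:Z); last lia.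
  by have := w_incr i; rewrite wP; lia.
have w_nat (i : nat) : w i%:Z = w 0 + i%:Z.
  by elim: i => [|i IH]; [rewrite addr0 | rewrite -addn1 PoszD wS IH addrA].
move/(affine_permE wP wB): wA; rewrite (eq_bigr _ (fun (i : 'I_n) _ => w_nat i)).
rewrite big_split /= sumr_const card_ord -[RHS]add0r => /addIr/eqP.
rewrite mulrn_eq0 gtn_eqF //= => /eqP w0.
by apply: (eq_shift_equivariant n_gt0) => // i _; rewrite w_nat w0 add0r.
Qed.

Lemma avoids132_id : avoids id [:: 1; 3; 2]%N.
Proof. by move=> /contains132P[i [j [k [? ? ? ?]]]]; lia. Qed.

Lemma avoids213_id : avoids id [:: 2; 1; 3]%N.
Proof. by move=> /contains3P[i [j [k [? ? _ [? _ _] _]]]]; lia. Qed.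

Lemma avoids132_increasing n w : (0 < n)%N -> affine_perm n w ->
  avoids w [:: 1; 3; 2]%N -> forall i : int, w i < w (i + 1).
Proof.
move=> n_gt0 [wB [wP _]] w_av i; rewrite ltNge; apply/negP => w_desc.
have {}w_desc : w (i + 1) < w i.
  by rewrite lt_neqAle w_desc andbT; apply/eqP => /(bij_inj wB); lia.
(* This [q] is large enough that moving [i] left by [q * n] brings its value below [w (i + 1)]. *)
pose q : int := w i - w (i + 1) + 1.
have q_n : q <= q * n%:Z by rewrite /q; nia.
apply: w_av; apply/contains132P; exists (i - q * n%:Z), i, (i + 1).
have := shift_equivariantM wP i (- q); rewrite mulNr => ->.
by split => //; lia.
Qed.

Lemma num_avoiders132 n : (0 < n)%N -> num_avoiders n [:: 1; 3; 2]%N 1.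
Proof.
move=> n_gt0; exists [:: window n id]; split=> //; split=> // v; rewrite inE; split.
  by move/eqP->; exists id; split; [exact: affine_perm_id | split=> //; exact: avoids132_id].
move=> [w [wA [w_av ->]]]; apply/eqP/eq_map => i.
by rewrite (affine_perm_increasing n_gt0 wA) //; apply: avoids132_increasing wA w_av.
Qed.

Lemma num_avoiders123 n : (0 < n)%N -> num_avoiders n [:: 1; 2; 3]%N 0.
Proof.
move=> n_gt0; exists [::]; split=> //; split=> // v; split=> //.
move=> [w [[_ [wP _]] [w_av _]]]; case: w_av; apply/contains123P.
have wn : w n%:Z = w 0 + n%:Z by rewrite -wP add0r.
(* The translates of a single position already form an increasing sequence. *)
by exists 0, n%:Z, (n%:Z + n%:Z); rewrite wP wn; split; lia.
Qed.

(** * 231-avoidance as laminarity over the suffix minima *)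

Lemma avoids231P w m : injective w -> suffix_min w m ->
  avoids w [:: 2; 3; 1]%N <-> laminar m w.
Proof.
move=> wI wm; split=> [w_av i j ij mj|lam /contains231P[i [j [k [ij jk wki wij]]]]].
  rewrite ltNge; apply/negP => wij; apply: w_av; apply/contains231P.
  (* The position where [m j] is attained carries the smallest entry of the 231. *)
  have [k jk wk] := wm.2 j; exists i, j, k.
  have wki : w k != w i by apply/eqP => /wI; lia.
  have wji : w j != w i by apply/eqP => /wI; lia.
  have kj : k != j by apply/eqP => kj; move: wk; rewrite kj; lia.
  by split; lia.
by have := lam _ _ ij; have := wm.1 _ _ (ltW jk); lia.
Qed.

(** * Encoding 231-avoiders by sorted tuples *)

Section TupleMin.

Variables (n : nat) (n_gt0 : (0 < n)%N).

(* The equivariant function with values [0, t_0, ..., t_(n-2)] at [0, ..., n-1]. *)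
Definition tuple_min (t : n.-1.-tuple 'I_n.+1) (i : int) : int :=
  (nth 0%N (0%N :: map val t) (absz (i %% n%:Z)%Z))%:Z + (i %/ n%:Z)%Z * n%:Z.

Implicit Type t : n.-1.-tuple 'I_n.+1.

Let n0 : n%:Z != 0. Proof. by lia. Qed.

Lemma tuple_min_shift t : shift_equivariant n (tuple_min t).
Proof.
by move=> i; rewrite /tuple_min modzDr divzDr ?dvdzz // divzz n0 mulrDl mul1r addrA.
Qed.

Lemma tuple_min_nat t (i : nat) : (i < n)%N ->
  tuple_min t i%:Z = (nth 0%N (0%N :: map val t) i)%:Z.
Proof.
move=> i_lt; rewrite /tuple_min modz_small ?divz_small ?mul0r ?addr0 //; lia.
Qed.

Lemma tuple_min_homo t : sorted leq (map val t) ->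
  {homo tuple_min t : i j / i <= j}.
Proof.
move=> t_sorted i j; rewrite /tuple_min.
have divE k : k = (k %/ n%:Z)%Z * n%:Z + (absz (k %% n%:Z)%Z)%:Z.
  by rewrite gez0_abs ?modz_ge0 // -divz_eq.
have r_lt k : (absz (k %% n%:Z)%Z < n)%N.
  by have := ltz_pmod k (_ : 0 < n%:Z); have := modz_ge0 k n0; lia.
rewrite [in X in X -> _](divE i) [in X in X -> _](divE j).
have := r_lt i; have := r_lt j.
move: (absz _) (absz _) (divz _ _) (divz _ _) => ri rj qj qi rj_lt ri_lt ij.
set s := 0%N :: _.
have s_le r : (nth 0%N s r <= n)%N.
  case: (ltnP r (size s)) => [/(mem_nth 0%N)|/(nth_default 0%N)-> //].
  by rewrite inE => /orP[/eqP-> //|/mapP[x _ ->]]; rewrite -ltnS ltn_ord.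
have s_sorted : sorted leq s by rewrite /= path_min_sorted //; apply/allP.
have s_size : size s = n by rewrite /= size_map size_tuple prednK.
have step (a b : int) : a < b -> a * n%:Z + n%:Z <= b * n%:Z.
  by move=> ab; rewrite -{2}[n%:Z]mul1r -mulrDl ler_wpM2r //; lia.
(* Across blocks of length [n], entries at most [n] cannot exceed the start of the next block;
   within one block, sortedness decides. *)
case: (ltrgtP qi qj) => [/step q_lt|/step q_gt|q_eq].
- by have := s_le ri; lia.
- by lia.
rewrite q_eq lerD2r lez_nat.
by apply: (sorted_leq_nth leq_trans leqnn); rewrite ?inE ?s_size //; lia.
Qed.

Lemma tuple_min_inj t t' : tuple_min t =1 tuple_min t' -> t = t'.
Proof.
move=> tt'; apply: eq_from_tnth => k; apply: val_inj.
have := tt' k.+1; rewrite !tuple_min_nat; try by have := ltn_ord k; lia.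
case=> /=; rewrite !(nth_map ord0) ?size_tuple //.
by rewrite !(tnth_nth ord0).
Qed.

(** Monotonicity and [m n = m 0 + n] put the differences [m k - m 0], for [0 < k < n], between [0]
    and [n]; these are the entries of the tuple. *)
Lemma tuple_min_surj m : shift_equivariant n m -> {homo m : i j / i <= j} ->
  exists2 t : n.-1.-tuple 'I_n.+1, sorted leq (map val t) & forall i, m i = tuple_min t i + m 0.
Proof.
move=> mP m_homo.
have m_le (i : nat) : (i < n)%N -> m 0 <= m i%:Z <= m 0 + n%:Z.
  by move=> i_lt; rewrite -mP !m_homo //; lia.
pose v (k : nat) : nat := absz (m k.+1%:Z - m 0)%R.
pose t : n.-1.-tuple 'I_n.+1 := [tuple inord (v k) | k < n.-1].
have v_le (k : nat) : (k < n.-1)%N -> (v k < n.+1)%N.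
  by move=> k_lt; rewrite /v; have := m_le k.+1 (_ : _); lia.
have nth_t (k : nat) : (k < n.-1)%N -> nth 0%N (map val t) k = v k.
  move=> k_lt; rewrite (nth_map ord0) ?size_tuple //.
  by rewrite -(tnth_nth _ _ (Ordinal k_lt)) tnth_mktuple /= inordK // v_le.
exists t.
  apply: (path_sorted (x := 0%N)); apply/(pathP 0%N) => i.
  rewrite size_map size_tuple => i_lt; rewrite nth_t //.
  case: i i_lt => [//|i] i_lt; rewrite /= nth_t; last lia.
  have := m_le i.+1 (_ : _); have := m_le i.+2 (_ : _).
  have := m_homo i.+1%:Z i.+2%:Z (_ : _).
  by rewrite /v; lia.
apply: (eq_shift_equivariant n_gt0) => // [i|i i_lt].
  by rewrite tuple_min_shift addrAC.
rewrite tuple_min_nat //; case: i i_lt => [|i] i_lt; first by rewrite add0r.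
by rewrite /= nth_t; [have := m_le _ i_lt; rewrite /v|]; lia.
Qed.

Definition avoider (t : n.-1.-tuple 'I_n.+1) (i : int) : int :=
  stack_word n (tuple_min t) i + centering n (stack_word n (tuple_min t)).

Section Avoider.

Variables (t : n.-1.-tuple 'I_n.+1) (t_sorted : sorted leq (map val t)).

Let mP := tuple_min_shift t.
Let m_homo := tuple_min_homo t_sorted.

Lemma avoider_affine : affine_perm n (avoider t).
Proof.
apply: affine_perm_centering => //; first exact: stack_word_shift.
exact: stack_word_inj.
Qed.

Lemma avoider_suffix_min : suffix_min (avoider t)
  (fun i => tuple_min t i + centering n (stack_word n (tuple_min t))).
Proof. exact/suffix_min_add/stack_word_suffix_min. Qed.

Lemma avoider_avoids231 : avoids (avoider t) [:: 2; 3; 1]%N.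
Proof.
have [/bij_inj wI _] := avoider_affine.
apply/(avoids231P wI avoider_suffix_min) => i j ij.
rewrite lerD2r ltrD2r; exact: stack_word_laminar.
Qed.

End Avoider.

(** The suffix minima of [w] give [t], up to a constant. A translate of [avoider t] is then laminar
    over the same [m], hence equal to [w], and equal window sums force the translation to vanish. *)
Lemma avoider_surj w : affine_perm n w -> avoids w [:: 2; 3; 1]%N ->
  exists2 t : n.-1.-tuple 'I_n.+1, sorted leq (map val t) & w =1 avoider t.
Proof.
move=> wA w_av; have [wB [wP _]] := wA.
have [m wm] := suffix_min_ex n_gt0 wP.
have mP := suffix_min_shift wm wP.
have m_homo := suffix_min_homo wm.
have lam := (avoids231P (bij_inj wB) wm).1 w_av.
have [t t_sorted mt] := tuple_min_surj mP m_homo; exists t => //.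
pose c := centering n (stack_word n (tuple_min t)).
have tP := tuple_min_shift t; have t_homo := tuple_min_homo t_sorted.
have aA := avoider_affine t_sorted; have [aB [aP _]] := aA.
pose u i := avoider t i + (m 0 - c).
have wu : w =1 u.
  apply: (laminar_eq (m := m)) => //.
  - by move=> i; apply: wm.1.
  - by move=> i; rewrite mt /u /avoider -/c; have := stack_word_ge n (tuple_min t) i; lia.
  - have [a' aK a'K] := aB.
    by exists (fun i => a' (i - (m 0 - c))) => i; rewrite /u ?addrK ?aK ?a'K ?subrK.
  have am := avoider_suffix_min t_sorted.
  have := (avoids231P (bij_inj aB) am).1 (avoider_avoids231 t_sorted).
  move=> a_lam i j ij; rewrite mt /u ltrD2r => mj; apply: a_lam => //.
  by move: mj; rewrite -/c; lia.
move/(affine_permE wP wB): wA; have /(affine_permE aP aB) <- := aA.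
rewrite (eq_bigr _ (fun (i : 'I_n) _ => wu i)) big_split /= sumr_const card_ord.
rewrite -[RHS]addr0 => /addrI/eqP; rewrite mulrn_eq0 gtn_eqF //= => /eqP c0 i.
by rewrite wu /u c0 addr0.
Qed.

Lemma avoider_inj t t' : sorted leq (map val t) -> sorted leq (map val t') ->
  avoider t =1 avoider t' -> t = t'.
Proof.
move=> t_sorted t'_sorted tt'; apply: tuple_min_inj => i.
have am := avoider_suffix_min t_sorted.
have eq_min := suffix_min_unique am tt' (avoider_suffix_min t'_sorted).
(* Both [tuple_min] functions vanish at [0], so the two centering constants agree and cancel. *)
by have := eq_min i; have := eq_min 0; rewrite /= !tuple_min_nat //= !add0r => <- /addIr.
Qed.

End TupleMin.

(** * The counts *)

Lemma num_avoiders231 n : (0 < n)%N ->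
  num_avoiders n [:: 2; 3; 1]%N 'C(n.*2.-1, n).
Proof.
move=> n_gt0.
pose A := [set t : n.-1.-tuple 'I_n.+1 | sorted leq (map val t)].
exists [seq window n (avoider t) | t <- enum A]; split; [|split].
- rewrite map_inj_in_uniq ?enum_uniq // => t t'.
  rewrite !mem_enum !inE => t_sorted t'_sorted /eq_from_window tt'.
  apply: (avoider_inj n_gt0) => //; apply: tt' => //.
    by have [_ []] := avoider_affine n_gt0 t_sorted.
  by have [_ []] := avoider_affine n_gt0 t'_sorted.
(* The sorted tuples number ['C(n.-1 + n, n.-1)]; symmetry of the binomial turns the lower index
   into [n]. *)
- rewrite size_map -cardE card_sorted_tuples -bin_sub; last lia.
  by congr 'C(_, _); lia.
move=> v; split=> [/mapP[t]|[w [wA [w_av ->]]]].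
  rewrite mem_enum inE => t_sorted ->; exists (avoider t).
  by split; [exact: avoider_affine | split=> //; exact: avoider_avoids231].
have [t t_sorted wt] := avoider_surj n_gt0 wA w_av.
by apply/mapP; exists t; rewrite ?mem_enum ?inE //; apply: eq_map => i; rewrite wt.
Qed.

Theorem theorem4p1 :
  forall n : nat, (2 <= n)%N ->
    num_avoiders n [:: 1; 2; 3]%N 0 /\
    (affine_perm n id /\ avoids id [:: 1; 3; 2]%N /\ num_avoiders n [:: 1; 3; 2]%N 1) /\
    (affine_perm n id /\ avoids id [:: 2; 1; 3]%N /\ num_avoiders n [:: 2; 1; 3]%N 1) /\
    num_avoiders n [:: 2; 3; 1]%N 'C(n.*2.-1, n) /\
    num_avoiders n [:: 3; 1; 2]%N 'C(n.*2.-1, n).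
Proof.
move=> n /ltnW n_gt0; have id_affine := affine_perm_id n.
have av132 := num_avoiders132 n_gt0; have av231 := num_avoiders231 n_gt0.
split; first exact: num_avoiders123.
split; first by split=> //; split=> //; exact: avoids132_id.
split; last by split=> //; exact: num_avoiders_rev_compl av231.
split=> //; split; first exact: avoids213_id.
exact: num_avoiders_rev_compl av132.
Qed.
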